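(* Let $R\subseteq S$ be a module-finite étale ring extension with conductor $C:=(R:S)$. Then: (1) $R\subseteq S$ has FIP and is seminormal if and only if $R/C$ is Artinian and reduced. (2) $R\subseteq S$ has FIP and $R/C$ is reduced if and only if $R\subseteq S$ is seminormal and $R/C$ is Artinian.
   Context: All rings considered are commutative and unital, and $R$ is nonzero. For a ring extension $R\subseteq S$, $[R,S]$ is the set of all $R$-subalgebras of $S$; the extension has FIP if $[R,S]$ is finite. The conductor is $(R:S)=\{x\in R\mid xS\subseteq R\}$. $R\subseteq S$ is seminormal if $b\in S$ and $b^2,b^3\in R$ imply $b\in R$. A ring morphism $R\to S$ is étale if it is flat, of finite presentation, and $\Omega_{S|R}=0$ (module of Kähler differentials). *)

(* Defs.v *)
From HB Require Import structures.
From mathcomp Require Import all_boot all_order all_algebra.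
From mathcomp Require Import generic_quotient ring_quotient.
From mathcomp Require Import boolp classical_sets cardinality.
From mathcomp Require Import freeg mpoly.

Set Implicit Arguments.
Unset Strict Implicit.
Unset Printing Implicit Defensive.

Import GRing.Theory.
Local Open Scope ring_scope.
Local Open Scope quotient_scope.

(* In this file an extension of commutative rings R ⊆ S is a commutative
   R-algebra S whose structure map [in_alg S] is injective; an element of S
   "lies in R" when it is of the form r%:A. *)

Section Span.
Variables (R : nzRingType) (V : lmodType R) (G : set V).

Definition span : {pred V} := fun v =>
  `[< exists2 s : seq (R * V), (forall c, c \in s -> G c.2) &
        v = \sum_(c <- s) c.1 *: c.2 >].

Lemma span_closed : submod_closed span.
Proof.
split=> [|a u v]; first by apply/asboolP; exists [::]; rewrite ?big_nil.
move=> /asboolP[s sG ->] /asboolP[t tG ->]; apply/asboolP.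
exists ([seq (a * c.1, c.2) | c <- s] ++ t).
  by move=> c; rewrite mem_cat => /orP[/mapP[d /sG Gd ->]|/tG].
rewrite big_cat big_map scaler_sumr; congr (_ + _).
by apply: eq_bigr => c _; rewrite scalerA.
Qed.

HB.instance Definition _ := GRing.isSubmodClosed.Build R V span span_closed.

Lemma mem_span v : G v -> v \in span.
Proof.
move=> Gv; apply/asboolP; exists [:: (1, v)].
  by move=> c; rewrite inE => /eqP ->.
by rewrite big_seq1 scale1r.
Qed.

End Span.

Section QuotientModule.
Variables (R : nzRingType) (V : lmodType R) (G : set V).

Definition quotmod := Quotient.quot (span G).

HB.instance Definition _ := GRing.Zmodule.on quotmod.

Definition quotmod_pi (v : V) : quotmod := \pi_(Quotient.quot (span G)) v.

Lemma quotmod_eqP u v : quotmod_pi u = quotmod_pi v <-> u - v \in span G.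
Proof.
rewrite -[_ \in _]/(Quotient.equiv (span G) u v) /quotmod_pi.
by split=> [/eqP|uv]; [|apply/eqP]; rewrite piE.
Qed.

Lemma quotmod_piW (P : quotmod -> Prop) :
  (forall v, P (quotmod_pi v)) -> forall w, P w.
Proof. by move=> Pv w; rewrite -[w]reprK; exact: Pv. Qed.

Lemma quotmod_pi_is_zmod_morphism : zmod_morphism quotmod_pi.
Proof. exact: (raddfB (\pi_(Quotient.quot (span G)))). Qed.

HB.instance Definition _ :=
  GRing.isZmodMorphism.Build V quotmod quotmod_pi quotmod_pi_is_zmod_morphism.

Definition quotmod_scale (a : R) (w : quotmod) : quotmod :=
  quotmod_pi (a *: repr w).

Lemma quotmod_scaleE a v : quotmod_scale a (quotmod_pi v) = quotmod_pi (a *: v).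
Proof.
apply/quotmod_eqP; rewrite -scalerBr rpredZ //; apply/quotmod_eqP.
exact: reprK.
Qed.

Fact quotmod_scalerA a b w :
  quotmod_scale a (quotmod_scale b w) = quotmod_scale (a * b) w.
Proof. by elim/quotmod_piW: w => v; rewrite !quotmod_scaleE scalerA. Qed.

Fact quotmod_scale1r : left_id 1 quotmod_scale.
Proof. by elim/quotmod_piW => v; rewrite quotmod_scaleE scale1r. Qed.

Fact quotmod_scalerDr : right_distributive quotmod_scale +%R.
Proof.
move=> a; elim/quotmod_piW => u; elim/quotmod_piW => v.
by rewrite -raddfD !quotmod_scaleE scalerDr raddfD.
Qed.

Fact quotmod_scalerDl w : {morph quotmod_scale^~ w : a b / a + b}.
Proof.
by elim/quotmod_piW: w => v a b; rewrite !quotmod_scaleE scalerDl raddfD.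
Qed.

HB.instance Definition _ := GRing.Zmodule_isLmodule.Build R quotmod
  quotmod_scalerA quotmod_scale1r quotmod_scalerDr quotmod_scalerDl.

Lemma quotmod_pi_is_scalable : scalable quotmod_pi.
Proof. by move=> a v; rewrite -quotmod_scaleE. Qed.

HB.instance Definition _ :=
  GRing.isScalable.Build R V quotmod *:%R quotmod_pi quotmod_pi_is_scalable.

End QuotientModule.

Section Tensor.
Variable R : comNzRingType.

Variant tensor_rel (M N : lmodType R) : set {freeg (M * N) / R} :=
| TensorDl m m' n :
    tensor_rel (<< (m + m', n) >> - << (m, n) >> - << (m', n) >>)
| TensorDr m n n' :
    tensor_rel (<< (m, n + n') >> - << (m, n) >> - << (m, n') >>)
| TensorZl a m n : tensor_rel (<< (a *: m, n) >> - a *: << (m, n) >>)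
| TensorZr a m n : tensor_rel (<< (m, a *: n) >> - a *: << (m, n) >>).

Definition tensor (M N : lmodType R) := quotmod (@tensor_rel M N).

HB.instance Definition _ M N := GRing.Lmodule.on (tensor M N).

Definition tens (M N : lmodType R) (m : M) (n : N) : tensor M N :=
  quotmod_pi (@tensor_rel M N) << (m, n) >>.

(* f ⊗ id_N, computed on a representative; it does not
   depend on the choice, see [tensor_map_pi]. *)
Definition tensor_map (M M' N : lmodType R) (f : {linear M -> M'})
    (w : tensor M N) : tensor M' N :=
  fglift (fun p => tens (f p.1) p.2) (repr w).

Lemma tensDl (M N : lmodType R) (m m' : M) (n : N) :
  tens (m + m') n = tens m n + tens m' n.
Proof.
rewrite -raddfD; apply/quotmod_eqP; rewrite opprD addrA.
exact/mem_span/TensorDl.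
Qed.

Lemma tensDr (M N : lmodType R) (m : M) (n n' : N) :
  tens m (n + n') = tens m n + tens m n'.
Proof.
rewrite -raddfD; apply/quotmod_eqP; rewrite opprD addrA.
exact/mem_span/TensorDr.
Qed.

Lemma tensZl (M N : lmodType R) a (m : M) (n : N) :
  tens (a *: m) n = a *: tens m n.
Proof. by rewrite -linearZ; apply/quotmod_eqP/mem_span/TensorZl. Qed.

Lemma tensZr (M N : lmodType R) a (m : M) (n : N) :
  tens m (a *: n) = a *: tens m n.
Proof. by rewrite -linearZ; apply/quotmod_eqP/mem_span/TensorZr. Qed.

Lemma tensor_map_pi (M M' N : lmodType R) (f : {linear M -> M'}) v :
  tensor_map f (quotmod_pi (@tensor_rel M N) v) =
  fglift (fun p => tens (f p.1) p.2) v.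
Proof.
set h := fun p => _.
have hB := lift_is_additive h.
have h0 : fglift h 0 = 0 by rewrite -(subrr 0) hB subrr.
have hD : {morph fglift h : a b / a + b}.
  by move=> a b; rewrite -{1}[b]opprK hB -[- b]sub0r hB h0 sub0r opprK.
have hZ a D : fglift h (a *: D) = a *: fglift h D.
  rewrite -[a *: D]/(fgscale a D) -{2}[D]freeg_sumE /fgscale.
  rewrite !(big_morph _ hD h0) scaler_sumr.
  by apply: eq_bigr => p _; rewrite !liftU scalerA.
have h1 p : fglift h << p >> = h p by rewrite liftU scale1r.
have /quotmod_eqP/asboolP[s sG eq_s] :
    quotmod_pi (@tensor_rel M N) (repr (quotmod_pi (@tensor_rel M N) v)) =
    quotmod_pi _ v by exact: reprK.
apply/eqP; rewrite -subr_eq0 -hB eq_s; apply/eqP.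
elim: s sG {eq_s} => [|[a u] s IHs] sG; first by rewrite big_nil.
rewrite big_cons hD hZ IHs ?addr0; last first.
  by move=> c cs; apply: sG; rewrite inE cs orbT.
suff -> : fglift h u = 0 by rewrite scaler0.
have := sG (a, u); rewrite inE eqxx => /(_ isT) /= {sG}.
case=> *; rewrite !(hB, hZ, h1) /h /=.
- by rewrite linearD tensDl addrAC addrK subrr.
- by rewrite tensDr addrAC addrK subrr.
- by rewrite linearZ tensZl subrr.
- by rewrite tensZr subrr.
Qed.

Lemma tensor_mapE (M M' N : lmodType R) (f : {linear M -> M'}) m (n : N) :
  tensor_map f (tens m n) = tens (f m) n.
Proof. by rewrite tensor_map_pi liftU scale1r. Qed.

Definition flat (N : lmodType R) : Prop :=
  forall (M M' : lmodType R) (f : {linear M -> M'}),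
    injective f -> injective (@tensor_map M M' N f).

End Tensor.

Section Etale.
Variables (R : comNzRingType) (S : comAlgType R).

(* The relations defining Ω_{S|R} as a quotient of the free S-module on the
   symbols ds, s : S; the basis element << s >> stands for ds. *)
Variant kaehler_rel : set {freeg S / S} :=
| KaehlerD s t : kaehler_rel (<< s + t >> - << s >> - << t >>)
| KaehlerM s t : kaehler_rel (<< s * t >> - s *: << t >> - t *: << s >>)
| KaehlerC (r : R) : kaehler_rel << r%:A >>.

Definition kaehler := quotmod kaehler_rel.

HB.instance Definition _ := GRing.Lmodule.on kaehler.

(* S ≅ R[X_0, ..., X_(n-1)] / (f_0, ..., f_(m-1)) as R-algebras *)
Definition finitely_presented : Prop :=
  exists (n : nat) (x : 'I_n -> S) (m : nat) (f : 'I_m -> {mpoly R[n]}),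
    (forall s, exists p : {mpoly R[n]}, mmap (in_alg S) x p = s) /\
    (forall p : {mpoly R[n]}, mmap (in_alg S) x p = 0 <->
       exists g : 'I_m -> {mpoly R[n]}, p = \sum_(i < m) g i * f i).

Definition etale : Prop :=
  [/\ flat S, finitely_presented & forall w : kaehler, w = 0].

Definition module_finite : Prop :=
  exists (n : nat) (x : 'I_n -> S),
    forall s, exists a : 'I_n -> R, s = \sum_(i < n) a i *: x i.

Definition has_FIP : Prop :=
  finite_set [set A : pred S | GRing.subalg_closed A].

Definition seminormal : Prop :=
  forall b : S, (exists r : R, b ^+ 2 = r%:A) -> (exists r : R, b ^+ 3 = r%:A) ->
  exists r : R, b = r%:A.

Definition conductor : {pred R} := fun x =>
  `[< forall s : S, exists r : R, x%:A * s = r%:A >].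

Lemma conductor_zmod_closed : zmod_closed conductor.
Proof.
split=> [|x y /asboolP xC /asboolP yC]; apply/asboolP => s.
  by exists 0; rewrite !scale0r mul0r.
have [[r rE] [r' r'E]] := (xC s, yC s).
by exists (r - r'); rewrite !scalerBl mulrBl rE r'E.
Qed.

HB.instance Definition _ :=
  GRing.isZmodClosed.Build R conductor conductor_zmod_closed.

Lemma conductor_mull a x : x \in conductor -> a * x \in conductor.
Proof.
move=> /asboolP xC; apply/asboolP => s; have [r rE] := xC s.
by exists (a * r); rewrite -!scalerA -scalerAl rE.
Qed.

End Etale.

(* The ring structure that [ring_quotient] puts on [Quotient.quot] is limited to
   proper ideals; here the ideal may be the whole ring (the conductor is when
   R = S), so the quotient is only a [comPzRingType]. *)
Section QuotientRing.
Variables (R : comNzRingType) (I : zmodClosed R).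
Hypothesis I_ideal : forall a x, x \in I -> a * x \in I.

Definition quotring of (forall a x, x \in I -> a * x \in I) :=
  Quotient.quot I.

Local Notation Q := (quotring I_ideal).

HB.instance Definition _ := GRing.Zmodule.on Q.

Definition quotring_pi (x : R) : Q := \pi_(Quotient.quot I) x.

Lemma quotring_eqP x y : quotring_pi x = quotring_pi y <-> x - y \in I.
Proof.
rewrite -[_ \in _]/(Quotient.equiv I x y) /quotring_pi.
by split=> [/eqP|xy]; [|apply/eqP]; rewrite piE.
Qed.

Lemma quotring_piW (P : Q -> Prop) :
  (forall x, P (quotring_pi x)) -> forall w, P w.
Proof. by move=> Px w; rewrite -[w]reprK; exact: Px. Qed.

Lemma quotring_pi_is_zmod_morphism : zmod_morphism quotring_pi.
Proof. exact: (raddfB (\pi_(Quotient.quot I))). Qed.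

HB.instance Definition _ :=
  GRing.isZmodMorphism.Build R Q quotring_pi quotring_pi_is_zmod_morphism.

Definition quotring_one : Q := quotring_pi 1.
Definition quotring_mul (u v : Q) : Q := quotring_pi (repr u * repr v).

Lemma quotring_mulE x y :
  quotring_mul (quotring_pi x) (quotring_pi y) = quotring_pi (x * y).
Proof.
have reprP z : repr (quotring_pi z) - z \in I.
  by apply/quotring_eqP; exact: reprK.
apply/quotring_eqP; set x' := repr _; set y' := repr _.
rewrite -[x' * y'](subrK (x' * y)) -mulrBr -addrA -mulrBl.
by rewrite rpredD //; [|rewrite mulrC]; apply/I_ideal/reprP.
Qed.

Fact quotring_mulA : associative quotring_mul.
Proof.
elim/quotring_piW => x; elim/quotring_piW => y; elim/quotring_piW => z.
by rewrite !quotring_mulE mulrA.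
Qed.

Fact quotring_mulC : commutative quotring_mul.
Proof.
elim/quotring_piW => x; elim/quotring_piW => y.
by rewrite !quotring_mulE mulrC.
Qed.

Fact quotring_mul1 : left_id quotring_one quotring_mul.
Proof. by elim/quotring_piW => x; rewrite quotring_mulE mul1r. Qed.

Fact quotring_mulDl : left_distributive quotring_mul +%R.
Proof.
elim/quotring_piW => x; elim/quotring_piW => y; elim/quotring_piW => z.
by rewrite -raddfD !quotring_mulE mulrDl raddfD.
Qed.

HB.instance Definition _ := GRing.Zmodule_isComPzRing.Build Q
  quotring_mulA quotring_mulC quotring_mul1 quotring_mulDl.

Lemma quotring_pi_is_monoid_morphism : monoid_morphism quotring_pi.
Proof. by split=> // x y; rewrite -quotring_mulE. Qed.

HB.instance Definition _ :=
  GRing.isMonoidMorphism.Build R Q quotring_pi quotring_pi_is_monoid_morphism.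

End QuotientRing.

Definition mod_conductor (R : comNzRingType) (S : comAlgType R) :
    comPzRingType :=
  quotring (@conductor_mull R S).

Section RingProperties.
Variable A : comPzRingType.

Definition ideal (I : set A) : Prop :=
  [/\ I 0, forall x y, I x -> I y -> I (x + y) & forall a x, I x -> I (a * x)].

Definition artinian : Prop :=
  forall I : nat -> set A, (forall n, ideal (I n)) ->
  (forall n, (I n.+1 `<=` I n)%classic) ->
  exists n, forall m, (n <= m)%N -> I m = I n.

Definition reduced_ring : Prop := forall (x : A) n, x ^+ n = 0 -> x = 0.

End RingProperties.

(* Main.v *)
From HB Require Import structures.
Require Import Defs.
From mathcomp Require Import all_boot all_order all_algebra.
From mathcomp Require Import boolp classical_sets cardinality.
From mathcomp Require Import freeg.
From mathcomp Require Import fieldext.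

Set Implicit Arguments.
Unset Strict Implicit.
Unset Printing Implicit Defensive.

Import GRing.Theory.
Local Open Scope ring_scope.

(** Write C for the conductor and A for R/C.  Everything rests on one statement
    about a single point of the spectrum of A: if k is a residue field of R at
    a maximal ideal containing C, and K is a large enough extension of k, then
    every R-linear map from S to K is a K-linear combination of ring morphisms
    S -> K over R ([killed_spanned]).  Indeed S acts on such maps by (s f)(y) =
    f(s y), and each generator x_j of S satisfies a monic equation whose roots
    lie in K, so that the space of maps decomposes into generalized eigenspaces
    for the x_j.  If f is killed by the square of the ideal of a joint
    eigencharacter phi, then s |-> f(s y) - phi(s) f(y) is a derivation of S
    into K seen as an S-module through phi; it vanishes since the module of
    Kaehler differentials does ([no_double_eigen]).  So generalized
    eigenvectors are eigenvectors, and an eigenvector is a multiple of a ring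
    morphism.

    Let T be an R-subalgebra of S and let A be Artinian and reduced.  Then 1 is,
    modulo C, a sum of elements e that are 0 in A or whose annihilator in A is a
    maximal ideal ([sum_of_simple]), and s lies in T as soon as e s does for each
    such e.  If e s were not in T, a linear map into the residue field
    at e would vanish on T and not at s; writing it as a combination of ring
    morphisms, independence of characters on T yields two ring morphisms that
    agree on T but not at s. Hence T is determined by the pairs of ring
    morphisms that agree on it ([points_separate]).  There are only finitely
    many ring morphisms, since they map x_j to a root of its equation; this
    gives FIP.  Seminormality is the case T = R: the value of a ring morphism
    over R at b is determined by its values at b^2 and b^3.

    For the converses, seminormality makes A reduced because if x^2 lies in C,
    then the square and the cube of x s lie in R for all s in S.  If FIP holds
    and A is reduced, descending chains of ideals I of A give descending chains
    of subalgebras R + IS, which are stationary.  Applied to the powers of one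
    element, this makes A von Neumann regular by the determinant trick
    ([FIP_regular]); and over a regular ring the chain of the R + IS determines
    where the chain of the I stops ([FIP_artinian]).  The theorem combines
    these implications. *)

(** * Derivations and Kaehler differentials *)

Section Derivation.
Variables (R : comNzRingType) (S : comAlgType R) (V : lmodType S) (D : S -> V).

(** The free S-module on the symbols ds maps to V by ds |-> D s, and this map
    kills the relations that define the module of differentials. *)
Lemma derivation_eq0 :
  (forall w : kaehler S, w = 0) -> {morph D : s t / s + t} ->
  (forall s t, D (s * t) = s *: D t + t *: D s) ->
  (forall r : R, D r%:A = 0) -> forall s, D s = 0.
Proof.
move=> Omega0 DD DM DC s.
have hB := lift_is_additive D.
have h0 : fglift D 0 = 0 by rewrite -(subrr 0) hB subrr.
have hD : {morph fglift D : a b / a + b}.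
  by move=> a b; rewrite -{1}[b]opprK hB -[- b]sub0r hB h0 sub0r opprK.
have hZ a (w : {freeg S / S}) : fglift D (a *: w) = a *: fglift D w.
  rewrite -[a *: w]/(fgscale a w) -{2}[w]freeg_sumE /fgscale.
  rewrite !(big_morph _ hD h0) scaler_sumr.
  by apply: eq_bigr => p _; rewrite !liftU scalerA.
have h1 t : fglift D << t >> = D t by rewrite liftU scale1r.
have : quotmod_pi (@kaehler_rel R S) << s >> = quotmod_pi (@kaehler_rel R S) 0.
  by rewrite raddf0; exact: Omega0.
move=> /quotmod_eqP; rewrite subr0 => /asboolP[l lG eq_s].
rewrite -h1 eq_s.
elim: l lG {eq_s} => [|[a u] l IHl] lG; first by rewrite big_nil.
rewrite big_cons hD hZ IHl ?addr0; last first.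
  by move=> c cl; apply: lG; rewrite inE cl orbT.
suff -> : fglift D u = 0 by rewrite scaler0.
have := lG (a, u); rewrite inE eqxx => /(_ isT) /=.
case=> *; rewrite ?(hB, hZ, h1) //.
- by rewrite DD addrAC addrK subrr.
- by rewrite DM addrAC addrK subrr.
Qed.

End Derivation.

Section Twist.
Variables (S : comNzRingType) (K : fieldType) (phi : {rmorphism S -> K}).

(** The field K as an S-module through phi. *)
Definition twist of {rmorphism S -> K} : Type := K.
Local Notation V := (twist phi).
HB.instance Definition _ := GRing.Zmodule.on V.

Definition twist_scale (s : S) (v : V) : V := phi s * (v : K).

Fact twist_scaleA a b v : twist_scale a (twist_scale b v) = twist_scale (a * b) v.
Proof. by rewrite /twist_scale rmorphM mulrA. Qed.
Fact twist_scale1 : left_id 1 twist_scale.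
Proof. by move=> v; rewrite /twist_scale rmorph1 mul1r. Qed.
Fact twist_scaleDr : right_distributive twist_scale +%R.
Proof. by move=> a u v; rewrite /twist_scale mulrDr. Qed.
Fact twist_scaleDl v : {morph twist_scale^~ v : a b / a + b}.
Proof. by move=> a b; rewrite /twist_scale rmorphD mulrDl. Qed.

HB.instance Definition _ := GRing.Zmodule_isLmodule.Build S V
  twist_scaleA twist_scale1 twist_scaleDr twist_scaleDl.
End Twist.

(** * Linear maps to a field and ring morphisms to it *)

Section Points.
Variables (R : comNzRingType) (S : comAlgType R) (K : fieldType).
Variable rho : {rmorphism R -> K}.
Implicit Types (f g h phi : S -> K) (s t y : S) (c d : K).

Definition semilinear f :=
  {morph f : y z / y + z} /\ forall (r : R) y, f (r *: y) = rho r * f y.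

(** A K-valued point of the spectrum of S above the point rho of the spectrum
    of R. *)
Definition point phi :=
  [/\ semilinear phi, phi 1 = 1 & {morph phi : s t / s * t}].

Lemma semilinear0 f : semilinear f -> f 0 = 0.
Proof. by case=> _ fZ; rewrite -(scale0r 0) fZ rmorph0 mul0r. Qed.

Lemma semilinear_sum f n (a : 'I_n -> R) (z : 'I_n -> S) : semilinear f ->
  f (\sum_(i < n) a i *: z i) = \sum_(i < n) rho (a i) * f (z i).
Proof.
move=> fL; have [fD fZ] := fL.
by rewrite (big_morph f fD (semilinear0 fL)); apply: eq_bigr => i _; rewrite fZ.
Qed.

Lemma pointC phi (r : R) : point phi -> phi r%:A = rho r.
Proof. by case=> -[_ phiZ] phi1 _; rewrite phiZ phi1 mulr1. Qed.

Lemma point_derivation_eq0 phi (D : S -> K) :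
  (forall w : kaehler S, w = 0) -> point phi ->
  {morph D : s t / s + t} ->
  (forall s t, D (s * t) = phi s * D t + phi t * D s) ->
  (forall r : R, D r%:A = 0) -> forall s, D s = 0.
Proof.
move=> Omega0 phiP DD DM DC.
have [phiL phi1 phiM] := phiP; have [phiD phiZ] := phiL.
have phiB : zmod_morphism phi.
  move=> s t; rewrite phiD; congr (_ + _).
  by rewrite -scaleN1r phiZ rmorphN1 mulN1r.
have phiMM : monoid_morphism phi by [].
pose aM := GRing.isZmodMorphism.Build S K phi phiB.
pose mM := GRing.isMonoidMorphism.Build S K phi phiMM.
pose Phi : {rmorphism S -> K} := HB.pack phi aM mM.
exact: (@derivation_eq0 R S (twist Phi) D).
Qed.

(** [shift s c] is the operator s - c for the action (s f)(y) = f(s y) of S on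
    maps from S to K, and [shifts s l] is the product of the s - c for c in l.
    *)
Definition shift s c f : S -> K := fun y => f (s * y) - c * f y.

Definition shifts s (l : seq K) f := foldl (fun g c => shift s c g) f l.

Lemma shiftC s t c d f : shift s c (shift t d f) = shift t d (shift s c f).
Proof.
apply: funext => y.
rewrite /shift (mulrCA t) !mulrBr !opprB !addrA (mulrCA c).
by rewrite [LHS](ACl (1*4*3*2)).
Qed.

Lemma shifts_shift s t l c f :
  shifts s l (shift t c f) = shift t c (shifts s l f).
Proof. by elim: l f => //= d l IHl f; rewrite shiftC IHl. Qed.

Lemma shifts_rem s l c f : c \in l ->
  shifts s (rem c l) (shift s c f) = shifts s l f.
Proof.
elim: l f => //= d l IHl f; rewrite inE; case: eqVneq => [->//|_] /= cl.
by rewrite -IHl // shiftC.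
Qed.

Lemma semilinear_shift s c f : semilinear f -> semilinear (shift s c f).
Proof.
case=> fD fZ; split=> [y z|r y]; rewrite /shift.
  by rewrite mulrDr !fD mulrDr opprD addrACA.
by rewrite -scalerAr !fZ mulrCA -mulrBr.
Qed.

Lemma shift_eq0 s t c f : (forall y, f y = 0) -> forall y, shift s c f y = 0.
Proof. by move=> f0 y; rewrite /shift !f0 mulr0 subr0. Qed.

Definition spanned f := exists2 l : seq (K * (S -> K)),
  (forall p, p \in l -> point p.2) & forall y, f y = \sum_(p <- l) p.1 * p.2 y.

Lemma spanned_comb c d f g h : spanned f -> spanned g ->
  (forall y, h y = c * f y + d * g y) -> spanned h.
Proof.
move=> [lf lfP fE] [lg lgP gE] hE.
exists ([seq (c * p.1, p.2) | p <- lf] ++ [seq (d * p.1, p.2) | p <- lg]).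
  by move=> p; rewrite mem_cat => /orP[]/mapP[q ql ->] /=; [exact: lfP|exact: lgP].
move=> y; rewrite hE fE gE big_cat !big_map !mulr_sumr.
by congr (_ + _); apply: eq_bigr => p _; rewrite mulrA.
Qed.

Section Generated.
Variables (n : nat) (x : 'I_n -> S).
Hypothesis x_gen : forall s, exists a : 'I_n -> R, s = \sum_(i < n) a i *: x i.

Lemma eigen_eq0 f (lam : 'I_n -> K) : semilinear f ->
  (forall j y, shift (x j) (lam j) f y = 0) -> f 1 = 0 -> forall y, f y = 0.
Proof.
move=> fL f_eig f1 y; have [a ->] := x_gen y.
rewrite semilinear_sum // big1 // => j _.
have := f_eig j 1; rewrite /shift mulr1 f1 mulr0 subr0 => ->.
by rewrite mulr0.
Qed.

(** Since the x_j generate S, each s acts on f by a scalar, which is f s / f 1;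
    scalars of an action are multiplicative in s. *)
Lemma eigen_point f (lam : 'I_n -> K) : semilinear f ->
    (forall j y, shift (x j) (lam j) f y = 0) -> f 1 != 0 ->
  exists phi, [/\ point phi, forall j, phi (x j) = lam j
                & forall s y, f (s * y) = phi s * f y].
Proof.
move=> fL f_eig f1; have [fD fZ] := fL.
pose phi s := f s / f 1.
have fM s y : f (s * y) = phi s * f y.
  have [a ->] := x_gen s; set mu := \sum_(i < n) rho (a i) * lam i.
  suff E z : f ((\sum_(i < n) a i *: x i) * z) = mu * f z.
    by rewrite E /phi -[X in f X / _]mulr1 E mulfK.
  rewrite mulr_suml; under eq_bigr do rewrite -scalerAl.
  rewrite (semilinear_sum a (fun i => x i * z) fL) /mu mulr_suml.
  apply: eq_bigr => i _; rewrite -mulrA; congr (_ * _).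
  by apply/eqP; rewrite -subr_eq0; apply/eqP/f_eig.
exists phi; split=> //; last first.
  move=> j; apply: (mulIf f1); rewrite -fM mulr1.
  by have /eqP := f_eig j 1; rewrite /shift mulr1 subr_eq0 => /eqP.
split; last 1 first.
- by move=> s t; rewrite {1}/phi fM -mulrA.
- by split=> [y z|r y]; rewrite /phi ?fD ?fZ ?mulrDl ?mulrA.
- by rewrite /phi divff.
Qed.

Hypothesis Omega0 : forall w : kaehler S, w = 0.

(** The ideal of the eigencharacter acts on f with square zero.  If some h =
    (x_i - lam_i) f were nonzero, it would be an eigenvector, whose
    eigencharacter phi is a point.  Then D_y(s) = f(s y) - phi(s) f(y)
    satisfies D_y(s t) = D_(t y)(s) + phi(s) D_y(t), and D_(t y)(s) = phi(t)
    D_y(s) because f is killed by the square, so D_y is a derivation and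
    vanishes. *)
Lemma no_double_eigen f (lam : 'I_n -> K) : semilinear f ->
    (forall i j y, shift (x i) (lam i) (shift (x j) (lam j) f) y = 0) ->
  forall i y, shift (x i) (lam i) f y = 0.
Proof.
move=> fL f_eig2 i; set h := shift (x i) (lam i) f.
have hL : semilinear h by exact: semilinear_shift.
have h_eig j y : shift (x j) (lam j) h y = 0 by exact: f_eig2.
have [h1|h1] := eqVneq (h 1) 0; first exact: eigen_eq0 hL h_eig h1.
have [phi [phiP phix _]] := eigen_point hL h_eig h1.
have [phiL _ phiM] := phiP; have [phiD phiZ] := phiL; have [fD fZ] := fL.
pose D y s := f (s * y) - phi s * f y.
have DE y a : D y (\sum_(j < n) a j *: x j) =
    \sum_(j < n) rho (a j) * shift (x j) (lam j) f y.
  rewrite /D mulr_suml; under eq_bigr do rewrite -scalerAl.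
  rewrite (semilinear_sum a (fun i => x i * y) fL) semilinear_sum //.
  rewrite mulr_suml -sumrB; apply: eq_bigr => j _.
  by rewrite phix /shift mulrBr mulrA.
have gM j t y :
    shift (x j) (lam j) f (t * y) = phi t * shift (x j) (lam j) f y.
  have gL := semilinear_shift (x j) (lam j) fL.
  have [a ->] := x_gen t.
  rewrite mulr_suml; under eq_bigr do rewrite -scalerAl.
  rewrite (semilinear_sum a (fun i => x i * y) gL) semilinear_sum // mulr_suml.
  apply: eq_bigr => k _; rewrite phix -mulrA; congr (_ * _).
  by apply/eqP; rewrite -subr_eq0; apply/eqP/f_eig2.
have DM y s t : D (t * y) s = phi t * D y s.
  have [a ->] := x_gen s; rewrite !DE mulr_sumr; apply: eq_bigr => j _.
  by rewrite gM mulrCA.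
have D0 y s : D y s = 0.
  apply: (point_derivation_eq0 Omega0 phiP) => {s} [s t|s t|r].
  - by rewrite /D mulrDl fD phiD mulrDl opprD addrACA.
  - suff -> : D y (s * t) = D (t * y) s + phi s * D y t by rewrite DM addrC.
    by rewrite /D phiM mulrBr !mulrA addrA (mulrC s) subrK.
  - by rewrite /D -scalerAl mul1r fZ pointC // subrr.
by move=> y; have := D0 y (x i); rewrite /D phix.
Qed.

Lemma update_size (l : 'I_n -> seq K) j (l' : seq K) N : size (l j) = (size l').+1 ->
  (\sum_i size (l i) < N.+1)%N ->
  (\sum_i size (if i == j then l' else l i) < N)%N.
Proof.
move=> szl; rewrite (bigD1 j) //= [X in (_ -> X < _)%N](bigD1 j) //= eqxx szl.
rewrite addSn ltnS; apply: leq_trans; rewrite ltnS leq_add2l.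
by apply/eq_leq/eq_bigr => i /negPf ->.
Qed.

(** Induction on the total number of factors: each (x_j - lam_j) f is killed by
    one factor less, hence is an eigenvector, and [no_double_eigen] applies. *)
Lemma primary_eigen f (lam : 'I_n -> K) (l : 'I_n -> seq K) : semilinear f ->
    (forall j c, c \in l j -> c = lam j) ->
    (forall j y, shifts (x j) (l j) f y = 0) ->
  forall j y, shift (x j) (lam j) f y = 0.
Proof.
have [N] := ubnP (\sum_i size (l i)).
elim: N f l => // N IHN f l leN fL llam lf.
apply: no_double_eigen => // i j y.
case El : (l j) => [|c l'].
  have f0 z : f z = 0 by have := lf j z; rewrite El.
  by rewrite !shift_eq0 // => z; exact: shift_eq0.
have cE : c = lam j by apply: llam; rewrite El mem_head.
pose l2 k := if k == j then l' else l k.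
apply: (IHN _ l2).
- by apply: update_size; rewrite ?El.
- exact: semilinear_shift.
- move=> k d; rewrite /l2; case: eqP => [->|_]; last exact: llam.
  by move=> dl; apply: llam; rewrite El inE dl orbT.
- move=> k z; rewrite /l2; case: eqP => [->|_].
    by have := lf j z; rewrite El /= cE.
  by rewrite shifts_shift shift_eq0.
Qed.

(** As long as the list of some x_j has two distinct entries c and d, f is a
    combination of (x_j - c) f and (x_j - d) f, which are killed by shorter
    lists; when none has, f belongs to a single generalized eigenspace. *)
Lemma killed_spanned f (l : 'I_n -> seq K) : semilinear f ->
  (forall j y, shifts (x j) (l j) f y = 0) -> spanned f.
Proof.
have [N] := ubnP (\sum_i size (l i)).
elim: N f l => // N IHN f l leN fL lf.
have [[j [c [d [cl dl cd]]]]|Nmixed] :=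
    pselect (exists j c d, [/\ c \in l j, d \in l j & c != d]).
  have shift_spanned e : e \in l j -> spanned (shift (x j) e f).
    move=> el; apply: (IHN _ (fun k => if k == j then rem e (l j) else l k)).
    - apply: update_size => //; rewrite size_rem //.
      by case: (l j) el.
    - exact: semilinear_shift.
    - move=> k z; case: eqP => [->|_]; first by rewrite shifts_rem.
      by rewrite shifts_shift shift_eq0.
  have cd0 : c - d != 0 by rewrite subr_eq0.
  apply: (spanned_comb (c := (c - d)^-1) (d := - (c - d)^-1)
            (shift_spanned d dl) (shift_spanned c cl)) => y.
  by rewrite /shift mulNr -mulrBr opprB [X in _ * X]addrC addrA subrK -mulrBl mulKf.
(* When l j is empty, f vanishes and any value of lam j will do. *)
pose lam j := head 0 (l j).
have llam j c : c \in l j -> c = lam j.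
  move=> cl; apply: contrapT => /eqP c_neq; apply: Nmixed; exists j, c, (lam j).
  split=> //; rewrite /lam; case: (l j) cl => //= d l' _.
  by rewrite mem_head.
have f_eig := primary_eigen fL llam lf.
have [f1|f1] := eqVneq (f 1) 0.
  by exists [::] => // y; rewrite big_nil (eigen_eq0 fL f_eig).
have [phi [phiP _ phiM]] := eigen_point fL f_eig f1.
exists [:: (f 1, phi)]; first by move=> p; rewrite inE => /eqP ->.
by move=> y; rewrite big_seq1 -{1}[y]mulr1 phiM mulrC.
Qed.

End Generated.

(** The independence of characters, for points restricted to T: when phi and psi
    differ at u in T, evaluating a relation at u t and subtracting phi(u) times
    its value at t removes phi from it, and likewise for psi; the difference of
    the two shorter relations at s is a nonzero multiple of the original one.
    When all points agree on T, they agree at s, and the relation at 1 says that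
    the coefficients add up to 0. *)
Lemma agreeing_points_relation (T : pred S) s (l : seq (K * (S -> K))) :
    T 1 -> (forall t u, T t -> T u -> T (t * u)) ->
    (forall p, p \in l -> point p.2) ->
    (forall phi psi, point phi -> point psi ->
       (forall t, T t -> phi t = psi t) -> phi s = psi s) ->
    (forall t, T t -> \sum_(p <- l) p.1 * p.2 t = 0) ->
  \sum_(p <- l) p.1 * p.2 s = 0.
Proof.
move=> T1 TM lP sT; have [N] := ubnP (size l).
elim: N l lP => // N IHN [|[c0 phi0] l] lP; first by rewrite big_nil.
move=> leN rel.
have P0 : point phi0 by exact: (lP (c0, phi0) (mem_head _ _)).
have [agree|] := pselect (forall p, p \in l -> forall t, T t -> p.2 t = phi0 t).
  have El t : (forall p, p \in l -> p.2 t = phi0 t) ->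
      \sum_(p <- (c0, phi0) :: l) p.1 * p.2 t =
      (\sum_(p <- (c0, phi0) :: l) p.1) * phi0 t.
    move=> Et; rewrite mulr_suml; apply: eq_big_seq => p; rewrite inE.
    by case/orP=> [/eqP-> //|/Et ->].
  have coef0 : \sum_(p <- (c0, phi0) :: l) p.1 = 0.
    have := rel 1 T1; rewrite El => [|p pl]; last exact: agree.
    by case: P0 => _ -> _; rewrite mulr1.
  rewrite El ?coef0 ?mul0r // => p pl; apply: sT => //; last exact: agree.
  by apply: lP; rewrite inE pl orbT.
move=> /existsNP[[c psi] /not_implyP[pl /existsNP[u /not_implyP[Tu /= uneq]]]].
have drop (q : K * (S -> K)) : q \in (c0, phi0) :: l ->
    \sum_(p <- (c0, phi0) :: l) p.1 * (p.2 u - q.2 u) * p.2 s = 0.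
  move=> ql.
  pose l' := [seq (p.1 * (p.2 u - q.2 u), p.2) | p <- rem q ((c0, phi0) :: l)].
  have E y : \sum_(p <- (c0, phi0) :: l) p.1 * (p.2 u - q.2 u) * p.2 y =
      \sum_(p <- l') p.1 * p.2 y.
    rewrite (perm_big _ (perm_to_rem ql)) big_cons /= subrr mulr0 mul0r add0r.
    by rewrite big_map.
  rewrite E; apply: IHN.
  - move=> p /mapP[p' /mem_rem p'l ->]; exact: (lP p').
  - by rewrite size_map size_rem.
  - move=> t Tt; rewrite -E.
    transitivity (\sum_(p <- (c0, phi0) :: l) p.1 * p.2 (u * t) -
        q.2 u * \sum_(p <- (c0, phi0) :: l) p.1 * p.2 t).
      rewrite mulr_sumr -sumrB; apply: eq_big_seq => p /lP[_ _ pM].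
      by rewrite pM mulrBr mulrBl mulrA [_ * q.2 u]mulrC -!mulrA.
    by rewrite !rel ?mulr0 ?subr0 //; exact: TM.
have drop0 := drop (c0, phi0) (mem_head _ _).
have dropl : \sum_(p <- (c0, phi0) :: l) p.1 * (p.2 u - psi u) * p.2 s = 0.
  by apply: (drop (c, psi)); rewrite inE pl orbT.
have d0 : psi u - phi0 u != 0 by rewrite subr_eq0; apply/eqP.
apply: (mulfI d0); rewrite mulr0.
transitivity (\sum_(p <- (c0, phi0) :: l) p.1 * (p.2 u - phi0 u) * p.2 s -
    \sum_(p <- (c0, phi0) :: l) p.1 * (p.2 u - psi u) * p.2 s); last first.
  by rewrite drop0 dropl subrr.
rewrite mulr_sumr -sumrB; apply: eq_bigr => p _.
by rewrite -mulrBl -mulrBr opprB [X in _ = _ * X * _]addrC addrA subrK mulrCA mulrA.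
Qed.

End Points.

(** * Fields and integral equations *)

Lemma irreducible_factor (F : fieldType) (p : {poly F}) : (1 < size p)%N ->
  exists2 q, irreducible_poly q & q %| p.
Proof.
have [N] := ubnP (size p); elim: N p => // N IHN p leN p1.
have [p_irr|] := pselect (irreducible_poly p); first by exists p.
move=> /not_andP[//|/existsNP[q /not_implyP[q1 /not_implyP[qp /negP nqp]]]].
have p0 : p != 0 by rewrite -size_poly_gt0 ltnW.
have q0 : q != 0 by apply: contraTneq qp => ->; rewrite dvd0p.
have qp_lt : (size q < size p)%N.
  rewrite ltn_neqAle dvdp_leq // andbT; apply: contraNneq nqp => sz.
  by rewrite -dvdp_size_eqp // sz.
have [||r r_irr rq] := IHN q.
- exact: leq_trans qp_lt _.
- by rewrite ltn_neqAle eq_sym q1 size_poly_gt0.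
by exists r => //; exact: dvdp_trans qp.
Qed.

Lemma splitting_field_exists (F : fieldType) (p : {poly F}) : p \is monic ->
  exists (L : fieldType) (iota : {rmorphism F -> L}) (rs : seq L),
    map_poly iota p = \prod_(r <- rs) ('X - r%:P).
Proof.
have [N] := ubnP (size p); elim: N F p => // N IHN F p leN p_monic.
have [p1|p1] := leqP (size p) 1.
  exists F, idfun, [::]; rewrite map_poly_id // big_nil.
  have /size_poly1P[c _ pc] : size p == 1.
    by rewrite eqn_leq p1 size_poly_gt0 monic_neq0.
  by move: p_monic; rewrite pc monicE lead_coefC => /eqP ->.
have [q q_irr qp] := irreducible_factor p1.
have [L _ [z qz _]] := irredp_FAdjoin q_irr.
have pz : root (map_poly (in_alg L) p) z.
  by apply: root_dvdp qz; rewrite dvdp_map.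
have /factor_theorem[p' pE] := pz.
have p'_monic : p' \is monic.
  by rewrite -(monicMr _ (monicXsubC z)) -pE map_monic.
have [|//|L' [iota [rs p'E]]] := IHN L p'.
  have := size_map_poly (in_alg L) p; rewrite pE.
  rewrite size_Mmonic ?monicXsubC //; last exact: monic_neq0.
  by rewrite size_XsubC addn2 /= => sz; rewrite -ltnS sz.
exists L', [the {rmorphism F -> L'} of iota \o in_alg L], (iota z :: rs).
by rewrite map_poly_comp pE rmorphM /= p'E map_polyXsubC big_cons mulrC.
Qed.

(** The quotient of R by the maximal ideal m; maximality is used elementwise, as
    the existence of inverses modulo m. *)
Lemma residue_field (R : comNzRingType) (m : R -> Prop) :
    m 0 -> (forall x y, m x -> m y -> m (x - y)) ->
    (forall a x, m x -> m (a * x)) -> ~ m 1 ->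
    (forall x, ~ m x -> exists y, m (1 - y * x)) ->
  exists (k : fieldType) (rho : {rmorphism R -> k}), forall r, rho r = 0 <-> m r.
Proof.
move=> m0 mB mM m1 mmax; pose I0 : {pred R} := fun r => `[< m r >].
have I_closed : zmod_closed I0.
  by split=> [|x y /asboolP mx /asboolP my]; apply/asboolP; [|exact: mB].
pose I : zmodClosed R := HB.pack I0 (GRing.isZmodClosed.Build R I0 I_closed).
have I_ideal a x : x \in I -> a * x \in I.
  by move=> /asboolP mx; apply/asboolP/mM.
pose Q := quotring I_ideal; pose pi : {rmorphism R -> Q} := quotring_pi I_ideal.
have pi0 r : pi r = 0 <-> m r.
  rewrite -(rmorph0 pi); split=> [/quotring_eqP|mr].
    by rewrite subr0 => /asboolP.
  by apply/quotring_eqP; rewrite subr0; apply/asboolP.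
have Q1 : 1 != 0 :> Q by apply/eqP; rewrite -(rmorph1 pi) => /pi0.
pose nzQ := GRing.PzSemiRing_isNonZero.Build Q Q1.
pose QN : comNzRingType := HB.pack Q nzQ.
have inv_ex (u : Q) : exists v : Q, (u != 0 -> v * u = 1) /\ (u = 0 -> v = 0).
  have [->|u0] := eqVneq u 0; first by exists 0.
  elim/quotring_piW: u u0 => x x0.
  have [|y /pi0] := mmax x; first by move/pi0 => xE; rewrite -/(pi x) xE eqxx in x0.
  rewrite rmorphB rmorphM rmorph1 => /subr0_eq yx.
  exists (pi y); split=> [_|xE]; first by rewrite -yx.
  by rewrite xE eqxx in x0.
have [inv invP] := choice inv_ex.
have invV (u : QN) : u != 0 -> (inv u : QN) * u = 1 by case: (invP u).
have inv0 : inv 0 = 0 by case: (invP 0) => _ ->.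
pose fieldQ := GRing.ComNzRing_isField.Build QN invV inv0.
pose k : fieldType := HB.pack Q nzQ fieldQ.
exists k, (pi : {rmorphism R -> k}).
exact: pi0.
Qed.

Lemma det_trick (S : comNzRingType) n (M : 'M[S]_n) (v : 'cV[S]_n) :
  M *m v = 0 -> forall i, \det M * v i 0 = 0.
Proof.
move=> Mv i; have : (\det M)%:M *m v = 0 by rewrite -mul_adj_mx -mulmxA Mv mulmx0.
by rewrite mul_scalar_mx => /matrixP/(_ i 0); rewrite !mxE.
Qed.

(** Evaluation at y of the polynomial det (1 - X B), whose value at 0 is 1. *)
Lemma det_one_sub_mul (R : comNzRingType) n (B : 'M[R]_n) (y : R) :
  exists b, \det (1%:M - y *: B) = 1 - b * y.
Proof.
pose q : {poly R} := \det (1%:M - 'X *: map_mx polyC B).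
have qE z : q.[z] = \det (1%:M - z *: B).
  rewrite -[LHS]/(horner_eval z _) -det_map_mx; congr (\det _).
  apply/matrixP => i j; rewrite !mxE /= /horner_eval.
  by rewrite hornerD hornerN hornerM hornerC hornerX hornerMn hornerC.
have /factor_theorem[p pE] : root (q - 1%:P) 0.
  by rewrite /root hornerD hornerN hornerC qE scale0r subr0 det1 subrr.
exists (- p.[y]); rewrite -qE -[q](subrK 1%:P) pE.
by rewrite hornerD hornerM hornerXsubC hornerC subr0 mulNr opprK addrC.
Qed.

Section Integral.
Variables (R : comNzRingType) (S : comAlgType R) (n : nat) (x : 'I_n -> S).
Hypothesis x_gen : forall s, exists a : 'I_n -> R, s = \sum_(i < n) a i *: x i.

Lemma module_finite_integral s :
  exists2 p : {poly R}, p \is monic & (map_poly (in_alg S) p).[s] = 0.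
Proof.
have [a aE] := choice (fun i => x_gen (s * x i)).
pose A : 'M[R]_n := \matrix_(i, j) a i j.
exists (char_poly A); first exact: char_poly_monic.
set M : 'M[S]_n := s%:M - map_mx (in_alg S) A.
have -> : (map_poly (in_alg S) (char_poly A)).[s] = \det M.
  rewrite map_char_poly -[LHS]/(horner_eval s _) -det_map_mx.
  congr (\det _); apply/matrixP => i j; rewrite !mxE /=.
  by rewrite /horner_eval hornerD hornerN hornerC hornerMn hornerX.
have Mx : M *m (\col_i x i) = 0.
  apply/matrixP => i j; rewrite mulmxBl mul_scalar_mx !mxE aE; apply/eqP.
  rewrite subr_eq0; apply/eqP/eq_bigr => k _.
  by rewrite !mxE -scalerAl mul1r.
have [b b1] := x_gen 1; rewrite -[LHS]mulr1 b1 mulr_sumr big1 // => i _.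
by have := det_trick Mx i; rewrite mxE -scalerAr => ->; rewrite scaler0.
Qed.

(** One polynomial for all generators, so that a single splitting field and a
    single list of roots serve them all. *)
Lemma common_integral : exists2 P : {poly R},
  P \is monic & forall j, (map_poly (in_alg S) P).[x j] = 0.
Proof.
have /choice[p pP] : forall j, exists p : {poly R},
    p \is monic /\ (map_poly (in_alg S) p).[x j] = 0.
  by move=> j; have [p] := module_finite_integral (x j); exists p.
exists (\prod_j p j); first by apply: monic_prod => j _; case: (pP j).
move=> j; rewrite rmorph_prod /= (bigD1 j) //= hornerM.
by case: (pP j) => _ ->; rewrite mul0r.
Qed.

End Integral.

Section KilledByRoots.
Variables (R : comNzRingType) (S : comAlgType R) (K : fieldType).
Variable rho : {rmorphism R -> K}.

(** The range of the sum is any N that contains the degree, so that the induction,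
    which removes one factor, can remove one term from the range as well. *)
Lemma shifts_poly (s : S) (l : seq K) (f : S -> K) y N :
    let q := \prod_(c <- l) ('X - c%:P) in (size q <= N)%N ->
  shifts s l f y = \sum_(i < N) q`_i * f (s ^+ i * y).
Proof.
elim: l f N => [|c l IHl] f N /=.
  rewrite big_nil size_poly1; case: N => // N _.
  rewrite big_ord_recl coef1 !mul1r big1 ?addr0 // => i _.
  by rewrite coef1 mul0r.
rewrite big_cons; set q := \prod_(_ <- l) _ => szq.
have q_monic : q \is monic by exact: monic_prod_XsubC.
case: N szq => [|N];
  rewrite size_monicM ?monicXsubC ?monic_neq0 // size_XsubC //= ltnS.
move=> szq; rewrite (IHl _ N) -/q //.
under [RHS]eq_bigr do rewrite mulrBl coefB coefCM mulrBl.
rewrite sumrB big_ord_recl coefXM mul0r add0r.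
rewrite [X in _ = _ - X]big_ord_recr /= nth_default // mulr0 mul0r addr0.
rewrite -sumrB; apply: eq_bigr => i _.
by rewrite coefXM /= /shift mulrBr exprS -!mulrA (mulrCA c).
Qed.

(** The product of the s - r over the roots r of P acts on f as P(s), that is,
    as 0. *)
Lemma shifts_roots_eq0 (f : S -> K) (P : {poly R}) (s : S) (rs : seq K) :
    semilinear rho f -> (map_poly (in_alg S) P).[s] = 0 ->
    map_poly rho P = \prod_(r <- rs) ('X - r%:P) ->
  forall y, shifts s rs f y = 0.
Proof.
move=> fL Ps PE y; have [_ fZ] := fL.
rewrite (@shifts_poly _ _ _ _ (size P)); last by rewrite -PE size_poly.
rewrite -PE; transitivity (f ((map_poly (in_alg S) P).[s] * y)); last first.
  by rewrite Ps mul0r (semilinear0 fL).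
rewrite (@horner_coef_wide _ (size P)) ?size_poly // mulr_suml.
transitivity (f (\sum_(i < size P) P`_i *: (s ^+ i * y))).
  rewrite (semilinear_sum (fun i => P`_i) (fun i => s ^+ i * y) fL).
  by apply: eq_bigr => i _; rewrite coef_map.
congr f; apply: eq_bigr => i _.
by rewrite coef_map /= -!scalerAl mul1r.
Qed.

End KilledByRoots.

(** * Artinian reduced rings *)

Section ArtinianReduced.
Variable A : comPzRingType.

(** In a von Neumann regular ring a finitely generated ideal is generated by an
    idempotent, and so has a unit; a new generator a, with local unit g, is
    added by passing from f to f + g - f g. *)
Lemma ideal_local_unit (I : set A) (l : seq A) :
    (forall y : A, exists u, y = u * y * y) ->
    ideal I -> (forall a, a \in l -> I a) ->
  exists2 f, I f & forall a, a \in l -> f * a = a.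
Proof.
move=> A_reg [I0 ID IM]; elim: l => [|a l IHl] lI; first by exists 0.
have [|f fI fP] := IHl; first by move=> b bl; apply: lI; rewrite inE bl orbT.
have [u uE] := A_reg a; have ga : u * a * a = a by rewrite -uE.
have gI : I (u * a) by apply/IM/lI/mem_head.
exists (f + u * a + (-1) * (f * (u * a))).
  by apply: (ID); [exact: ID|do 2!apply: (IM)].
move=> b; rewrite mulN1r mulrBl mulrDl inE => /orP[/eqP->|/fP fb].
  by rewrite ga -mulrA ga addrC addrA addNr add0r.
by rewrite fb [f * _]mulrC -[X in _ - X]mulrA fb addrK.
Qed.

(** The element (1 - c y) y is nilpotent. *)
Lemma reduced_regular (y c : A) n : reduced_ring A ->
  y ^+ n = c * y ^+ n.+1 -> y = c * y * y.
Proof.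
move=> A_reduced yE; apply/eqP; rewrite -subr_eq0; apply/eqP/(A_reduced _ n.+1).
have -> : y - c * y * y = (1 - c * y) * y by rewrite mulrBl mul1r.
have y0 : (1 - c * y) * y ^+ n = 0.
  by rewrite mulrBl mul1r -mulrA -exprS -yE subrr.
by rewrite exprMn !exprSr -mulrA [X in _ * X]mulrA y0 mul0r mulr0.
Qed.

Hypothesis A_artinian : artinian A.

Lemma principal_ideal (x : A) : ideal [set y | exists c, y = c * x]%classic.
Proof.
split=> [|y z [c ->] [d ->]|a y [c ->]]; first by exists 0; rewrite mul0r.
  by exists (c + d); rewrite mulrDl.
by exists (a * c); rewrite mulrA.
Qed.

Lemma artinian_principal (u : nat -> A) : (forall n, exists c, u n.+1 = c * u n) ->
  exists n c, u n = c * u n.+1.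
Proof.
move=> u_dec; pose I n := [set y | exists c, y = c * u n]%classic.
have [||n nI] := A_artinian (I := I).
- by move=> n; exact: principal_ideal.
- move=> n y [c ->]; have [d ->] := u_dec n.
  by exists (c * d); rewrite mulrA.
have : I n.+1 (u n) by rewrite nI //; exists 1; rewrite mul1r.
by case=> c uE; exists n, c.
Qed.

(** Well-founded induction on principal ideals: a counterexample would start an
    infinite strictly decreasing chain of them. *)
Lemma artinian_ind (P : A -> Prop) :
  (forall x, (forall a, ~ (exists b, x = b * (a * x)) -> P (a * x)) -> P x) ->
  forall x, P x.
Proof.
move=> Pstep x0; apply: contrapT => nPx0.
have /choice[g gP] : forall x, exists a,
    ~ P x -> ~ (exists b, x = b * (a * x)) /\ ~ P (a * x).
  move=> x; have [Px|nPx] := pselect (P x); first by exists 0.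
  have [a] : exists a, ~ (~ (exists b, x = b * (a * x)) -> P (a * x)).
    by apply/existsNP => /Pstep.
  by move=> /not_implyP[]; exists a.
pose u n := iter n (fun x => g x * x) x0.
have nPu n : ~ P (u n) by elim: n => //= n /gP[].
have [n|n [c uE]] := @artinian_principal u; first by exists (g (u n)).
by have [] := gP _ (nPu n); case; exists c.
Qed.

Hypothesis A_reduced : reduced_ring A.

Lemma artinian_reduced_regular (y : A) : exists u, y = u * y * y.
Proof.
have [n|n [c yE]] := @artinian_principal (fun n => y ^+ n).
  by exists y; rewrite exprS.
by exists c; exact: reduced_regular yE.
Qed.

(** Generators of ideals that are zero or minimal. *)
Definition simple_elt (e : A) := forall a, a * e = 0 \/ exists b, b * (a * e) = e.

(** If x is not simple, some nonzero y = a x generates a strictly smaller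
    ideal; it is generated by an idempotent f = u y, and x = f x + (1 - f) x,
    where both terms generate strictly smaller ideals. *)
Lemma sum_of_simple (x : A) :
  exists2 es : seq A, (forall e, e \in es -> simple_elt e) & x = \sum_(e <- es) e.
Proof.
elim/artinian_ind: x => x IHx.
have [x_simple|] := pselect (simple_elt x).
  by exists [:: x]; rewrite ?big_seq1 // => e; rewrite inE => /eqP ->.
move=> /existsNP[a /not_orP[/eqP ax0 nax]].
have [u yE] := artinian_reduced_regular (a * x); set y := a * x in yE ax0 nax.
have [|es1 es1P e1E] := IHx (u * y).
  move=> [b xE]; apply: nax; exists (b * u * x); rewrite [RHS]xE /y.
  by rewrite -!mulrA; congr (_ * (_ * _)); rewrite mulrCA.
have [|es2 es2P e2E] := IHx (1 - u * y).
  move=> [b xE]; move/eqP: ax0; apply.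
  have : y * x = 0.
    rewrite xE mulrCA [y * _]mulrA.
    have -> : y * (1 - u * y) = 0.
      by rewrite mulrBr mulr1 [y * _]mulrC -yE subrr.
    by rewrite mul0r mulr0.
  by move=> yx; rewrite yE {2}/y mulrCA -mulrA yx !mulr0.
exists (es1 ++ es2); first by move=> e; rewrite mem_cat => /orP[/es1P|/es2P].
by rewrite big_cat /= -e1E -e2E -mulrDl addrC subrK mul1r.
Qed.
End ArtinianReduced.

(** * Separation of subalgebras by points *)

Definition submodule (R : comNzRingType) (V : lmodType R) (W : V -> Prop) :=
  [/\ W 0, forall y z, W y -> W z -> W (y - z) & forall r y, W y -> W (r *: y)].

Section Functional.
Variables (R : comNzRingType) (S : comAlgType R) (n : nat) (x : 'I_n -> S).
Hypothesis x_gen : forall s, exists a : 'I_n -> R, s = \sum_(i < n) a i *: x i.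
Variables (K : fieldType) (rho : {rmorphism R -> K}).
Hypothesis rho_inv : forall r, rho r != 0 -> exists y, rho (1 - y * r) = 0.

Lemma submoduleD (V : lmodType R) (W : V -> Prop) y z :
  submodule W -> W y -> W z -> W (y + z).
Proof.
move=> [W0 WB WZ] Wy Wz; rewrite -[z]opprK -[- z]sub0r.
by apply: (WB) => //; exact: WB.
Qed.

(** The submodule is enlarged for one generator z at a time, so that modulo W'
    all of them become multiples of s: if z is not, then z can be adjoined to
    W' without reaching s, as a relation s = r z modulo W' with r invertible in
    the field would make z a multiple of s. *)
Lemma maximal_submodule (W : S -> Prop) s (l : seq S) : submodule W ->
    (forall r y, rho r = 0 -> W (r *: y)) -> ~ W s ->
  exists W' : S -> Prop, [/\ submodule W', forall y, W y -> W' y, ~ W' s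
    & forall z, z \in l -> exists r, W' (z - r *: s)].
Proof.
move=> Wsub Wker nWs; elim: l => [|z l [W' [W'sub WW' nW's IHl]]].
  by exists W; split.
have [[r W'z]|nW'z] := pselect (exists r, W' (z - r *: s)).
  exists W'; split=> // t; rewrite inE => /orP[/eqP->|/IHl //].
  by exists r.
have [W'0 W'B W'Z] := W'sub.
exists (fun y => exists r, W' (y - r *: z)); split.
- split=> [|y t [r Wy] [q Wt]|a y [r Wy]].
  + by exists 0; rewrite scale0r subr0.
  + exists (r - q).
    have -> : y - t - (r - q) *: z = (y - r *: z) - (t - q *: z).
      by rewrite scalerBl !opprB !addrA [RHS](ACl (1*4*3*2)).
    exact: W'B.
  + by exists (a * r); rewrite -scalerA -scalerBr; exact: W'Z.
- by move=> y Wy; exists 0; rewrite scale0r subr0; exact: WW'.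
- move=> [r W's]; have [r0|r0] := eqVneq (rho r) 0.
    apply: nW's; rewrite -[s](subrK (r *: z)).
    by apply: submoduleD => //; apply/WW'/Wker.
  have [y yr] := rho_inv r0; apply: nW'z; exists y.
  have -> : z - y *: s = (1 - y * r) *: z - y *: (s - r *: z).
    by rewrite scalerBl scale1r scalerBr opprB scalerA addrA subrK.
  by apply: W'B; [apply/WW'/Wker|exact: W'Z].
- move=> t; rewrite inE => /orP[/eqP->|/IHl[r W't]].
    by exists 0, 1; rewrite scale0r subr0 scale1r subrr.
  by exists r, 0; rewrite scale0r subr0.
Qed.

(** Modulo a submodule W' as in [maximal_submodule], S is a line over the
    residue field, spanned by s; f is the coordinate on that line. *)
Lemma separating_functional (W : S -> Prop) s : submodule W ->
    (forall r y, rho r = 0 -> W (r *: y)) -> ~ W s ->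
  exists f : S -> K, [/\ semilinear rho f, forall y, W y -> f y = 0 & f s = 1].
Proof.
move=> Wsub Wker nWs.
have [W' [W'sub WW' nW's W'x]] :=
  maximal_submodule [seq x i | i <- enum 'I_n] Wsub Wker nWs.
have [W'0 W'B W'Z] := W'sub.
have /choice[g gP] : forall y, exists r, W' (y - r *: s).
  have /choice[b bP] : forall i, exists r, W' (x i - r *: s).
    by move=> i; apply/W'x/map_f; rewrite mem_enum.
  move=> y; have [a ->] := x_gen y; exists (\sum_(i < n) a i * b i).
  rewrite scaler_suml -sumrB; elim/big_ind: _ => // [u v Wu Wv|i _].
    exact: submoduleD.
  by rewrite -scalerA -scalerBr; exact: W'Z.
have s_ker r : W' (r *: s) -> rho r = 0.
  move=> Wrs; apply/eqP; apply: contra_notT nW's => /rho_inv[y yr].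
  have -> : s = (1 - y * r) *: s + y *: (r *: s).
    by rewrite scalerBl scale1r scalerA subrK.
  by apply: submoduleD => //; [apply/WW'/Wker|exact: W'Z].
have g_uniq y r : W' (y - r *: s) -> rho (g y) = rho r.
  move=> Wy; apply/eqP; rewrite -subr_eq0 -rmorphB; apply/eqP/s_ker.
  rewrite scalerBl.
  have -> : g y *: s - r *: s = (y - r *: s) - (y - g y *: s).
    by rewrite opprB [RHS]addrC addrA subrK.
  exact: W'B.
exists (fun y => rho (g y)); split.
- split=> [y z|r y].
    rewrite -rmorphD; apply: g_uniq; rewrite scalerDl opprD addrACA.
    exact: submoduleD.
  rewrite -rmorphM; apply: g_uniq; rewrite -scalerA -scalerBr; exact: W'Z.
- by move=> y /WW' Wy; rewrite (g_uniq _ 0) ?rmorph0 // scale0r subr0.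
- by rewrite (g_uniq _ 1) ?rmorph1 // scale1r subrr.
Qed.

End Functional.

Section Subalgebra.
Variables (R : comNzRingType) (S : comAlgType R) (T : {pred S}).
Hypothesis T_subalg : GRing.subalg_closed T.

Lemma subalg0 : 0 \in T.
Proof. by have [T1 TL _] := T_subalg; rewrite -(subrr 1) -scaleN1r addrC TL. Qed.

Lemma subalgZ (r : R) s : s \in T -> r *: s \in T.
Proof.
have [_ TL _] := T_subalg; move=> sT; rewrite -[X in X \in T]addr0.
by rewrite TL ?subalg0.
Qed.

Lemma subalgD s t : s \in T -> t \in T -> s + t \in T.
Proof. by have [_ TL _] := T_subalg; move=> sT; rewrite -[s]scale1r; exact: TL. Qed.

Lemma conductor_scale (c : R) s : c \in conductor S -> c *: s \in T.
Proof.
have [T1 _ _] := T_subalg; move=> /asboolP/(_ s)[r]; rewrite mulr_algl => ->.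
exact: subalgZ.
Qed.

End Subalgebra.

Section Fibre.
Variables (R : comNzRingType) (S : comAlgType R) (n : nat) (x : 'I_n -> S).
Hypothesis x_gen : forall s, exists a : 'I_n -> R, s = \sum_(i < n) a i *: x i.
Hypothesis Omega0 : forall w : kaehler S, w = 0.

(** The lift to R of [simple_elt] for R/C.  When e is not in C, the r with r e
    in C form a maximal ideal. *)
Definition simple_mod_conductor (e : R) := forall a,
  a * e \in conductor S \/ exists b, e - b * (a * e) \in conductor S.

(** The y with e y in T form a submodule W that contains T, because e is in R,
    and m S, where m is the annihilator of e modulo C, because C S is contained
    in R.  So if e s is not in T, there is a linear map f to the residue field
    at m with f = 0 on T and f s = 1, against [agreeing_points_relation].  The
    roots rs are recorded because they bound the number of points. *)
Lemma points_separate e : simple_mod_conductor e -> e \notin conductor S ->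
  exists (K : fieldType) (rho : {rmorphism R -> K}) (rs : seq K),
    (forall phi, point rho phi -> forall j : 'I_n, phi (x j) \in rs) /\
    forall (T : {pred S}) s, GRing.subalg_closed T ->
      (forall phi psi : S -> K, point rho phi -> point rho psi ->
         {in T, phi =1 psi} -> phi s = psi s) ->
      e *: s \in T.
Proof.
move=> e_simple eC.
have [|||||k [rho0 rho0P]] := @residue_field R (fun r => r * e \in conductor S).
- by rewrite mul0r rpred0.
- by move=> y z yC zC; rewrite mulrBl rpredB.
- by move=> a y yC; rewrite -mulrA; exact: conductor_mull.
- by rewrite mul1r; apply/negP.
- move=> y yC; have [//|[b bE]] := e_simple y.
  by exists b; rewrite mulrBl mul1r -mulrA.
have [P P_monic Px] := common_integral x_gen.
have [K [iota [rs PE]]] : exists (L : fieldType) (iota : {rmorphism k -> L})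
    (rs : seq L), map_poly iota (map_poly rho0 P) = \prod_(r <- rs) ('X - r%:P).
  by apply: splitting_field_exists; exact: monic_map.
pose rho : {rmorphism R -> K} := [the {rmorphism R -> K} of iota \o rho0].
have rhoP r : rho r = 0 <-> r * e \in conductor S.
  rewrite -rho0P /=; split=> [/eqP|->]; last exact: rmorph0.
  by rewrite fmorph_eq0 => /eqP.
have {PE}PE : map_poly rho P = \prod_(r <- rs) ('X - r%:P).
  by rewrite -PE -map_poly_comp.
have rho_inv r : rho r != 0 -> exists y, rho (1 - y * r) = 0.
  move=> r0; have [rC|[b bE]] := e_simple r.
    by move/rhoP/eqP: rC r0 => ->.
  by exists b; apply/rhoP; rewrite mulrBl mul1r -mulrA.
exists K, rho, rs; split=> [phi phiP j|T s Tsub sT].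
  have [phiL phi1 phiM] := phiP.
  have := shifts_roots_eq0 phiL (Px j) PE 1.
  have -> : shifts (x j) rs phi 1 = \prod_(c <- rs) (phi (x j) - c).
    suff E l d f y : (forall z, f z = d * phi z) ->
        shifts (x j) l f y = d * (\prod_(c <- l) (phi (x j) - c)) * phi y.
      by rewrite (E rs 1 phi) ?mul1r ?phi1 ?mulr1 // => z; rewrite mul1r.
    elim: l d f => [|c l IHl] d f fE /=; first by rewrite big_nil mulr1.
    rewrite (IHl (d * (phi (x j) - c))) ?big_cons ?mulrA // => z.
    by rewrite /shift !fE phiM mulrCA -mulrBl mulrCA mulrA.
  by move/eqP; rewrite prodf_seq_eq0 => /hasP[c cl /=]; rewrite subr_eq0 => /eqP ->.
apply: contrapT => nes; have [T1 TL TM] := Tsub.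
have Wsub : submodule (fun y => e *: y \in T).
  split=> [|y z yT zT|r y yT]; first by rewrite scaler0 subalg0.
    by rewrite scalerBr addrC -scaleN1r TL.
  by rewrite scalerA mulrC -scalerA subalgZ.
have [|f [fL fW fs]] := separating_functional x_gen rho_inv Wsub _ nes.
  by move=> r y /rhoP rC; rewrite scalerA mulrC conductor_scale.
have [l lP fE] : spanned rho f.
  apply: (killed_spanned x_gen Omega0 (l := fun=> rs)) => // j.
  exact: shifts_roots_eq0 fL (Px j) PE.
have : f s = 0.
  rewrite fE; apply: (agreeing_points_relation (T := fun y => y \in T)) lP _ _ => //.
  by move=> t tT; rewrite -fE; apply: fW; exact: subalgZ.
by move/eqP; rewrite fs oner_eq0.
Qed.

(** The code of T is the set of pairs of points that agree on T, a point being
    encoded by the positions of its values at the x_j in the list of roots. *)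
Lemma fibre_code e : simple_mod_conductor e ->
  exists (J : finType) (code : {pred S} -> J), forall T T' : {pred S},
    GRing.subalg_closed T -> GRing.subalg_closed T' -> code T = code T' ->
    forall t, t \in T -> e *: t \in T'.
Proof.
move=> e_simple; have [eC|eC] := boolP (e \in conductor S).
  by exists unit, (fun=> tt) => T T' _ T'sub _ t _; exact: conductor_scale.
have [K [rho [rs [rootP sep]]]] := points_separate e_simple eC.
pose I : finType := {ffun 'I_n -> 'I_(size rs)}.
pose V (a : I) phi := point rho phi /\ forall j, phi (x j) = nth 0 rs (a j).
have V_ex phi : point rho phi -> exists a, V a phi.
  move=> phiP.
  have lt j : (index (phi (x j)) rs < size rs)%N by rewrite index_mem rootP.
  exists [ffun j => Ordinal (lt j)]; split=> // j.
  by rewrite ffunE nth_index ?rootP.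
have V_uniq a phi psi : V a phi -> V a psi -> phi =1 psi.
  move=> [[phiL _ _] phix] [[psiL _ _] psix] s; have [b ->] := x_gen s.
  rewrite (semilinear_sum _ _ phiL) (semilinear_sum _ _ psiL).
  by apply: eq_bigr => i _; rewrite phix psix.
pose code (T : {pred S}) : {set I * I} := [set p : I * I | `[< exists phi psi,
  [/\ V p.1 phi, V p.2 psi & {in T, phi =1 psi}] >]]%SET.
exists {set I * I}, code => T T' Tsub T'sub codeE t tT.
apply: sep => // phi psi phiP psiP agree.
have [[a Va] [b Vb]] := (V_ex phi phiP, V_ex psi psiP).
have : (a, b) \in code T' by rewrite inE; apply/asboolP; exists phi, psi.
rewrite -codeE inE => /asboolP[phi' [psi' [/= Va' Vb' agree']]].
by rewrite (V_uniq _ _ _ Va Va') (V_uniq _ _ _ Vb Vb'); exact: agree'.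
Qed.

End Fibre.

(** * The quotient by the conductor *)

Section ModConductor.
Variables (R : comNzRingType) (S : comAlgType R).
Local Notation A := (mod_conductor S).
Local Notation pi := (quotring_pi (@conductor_mull R S)).

Lemma mod_conductor_surj (u : A) : exists r, pi r = u.
Proof. by elim/quotring_piW: u => r; exists r. Qed.

Lemma mod_conductor_eq0 r : pi r = 0 <-> r \in conductor S.
Proof. by rewrite -(rmorph0 pi) quotring_eqP subr0. Qed.

(** If r^2 lies in C, then (r s)^2 = r^2 s^2 and (r s)^3 = r^2 (r s^3) lie in R for
    every s, so that r s lies in R. *)
Lemma seminormal_reduced : seminormal S -> reduced_ring A.
Proof.
move=> S_sn; suff sq0 (u : A) : u ^+ 2 = 0 -> u = 0.
  move=> u n; have [N] := ubnP n; elim: N n => // N IHN [|[|n]] leN un.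
  - by rewrite -[u]mul1r -(expr0 u) un mul0r.
  - by rewrite -[u]expr1.
  apply: (IHN n.+1) => //; apply: sq0.
  by rewrite -exprM muln2 -addnn addSnnS exprD un mulr0.
have [r <-] := mod_conductor_surj u; rewrite -rmorphXn.
move=> /mod_conductor_eq0/asboolP r2C; apply/mod_conductor_eq0/asboolP => s.
have r2 (t : S) : (r%:A * t) ^+ 2 = (r ^+ 2)%:A * t ^+ 2.
  by rewrite !expr2 mulrACA -scalerAl mul1r scalerA.
apply: S_sn; first by rewrite r2; exact: r2C.
rewrite exprS r2 mulrCA.
exact: r2C.
Qed.

Section Generated.
Variables (n : nat) (x : 'I_n -> S).
Hypothesis x_gen : forall s, exists a : 'I_n -> R, s = \sum_(i < n) a i *: x i.

Lemma alg_sum (I : finType) (F : I -> S) :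
  (forall i, exists r : R, F i = r%:A) -> exists r : R, \sum_i F i = r%:A.
Proof.
move=> FR; elim/big_ind: _ => [|u v [r ->] [q ->]|i _]; last exact: FR.
  by exists 0; rewrite scale0r.
by exists (r + q); rewrite scalerDl.
Qed.

Lemma conductor_gen c :
  (forall j, exists r : R, c *: x j = r%:A) -> c \in conductor S.
Proof.
move=> cx; apply/asboolP => s; have [a ->] := x_gen s.
rewrite mulr_algl scaler_sumr; apply: alg_sum => j.
by have [r rE] := cx j; exists (a j * r); rewrite -[RHS]scalerA -rE !scalerA mulrC.
Qed.

(** * FIP and seminormality over an Artinian reduced quotient *)

Section Etale.
Hypothesis Omega0 : forall w : kaehler S, w = 0.
Hypothesis A_artinian : artinian A.
Hypothesis A_reduced : reduced_ring A.

(** Modulo C, 1 is the sum of the e, and C s is contained in R. *)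
Lemma simple_decomposition : exists2 es : seq R,
  (forall e, e \in es -> simple_mod_conductor S e) &
  forall (T : {pred S}) s, GRing.subalg_closed T ->
    (forall e, e \in es -> e *: s \in T) -> s \in T.
Proof.
have [us us_simple one_us] := sum_of_simple A_artinian A_reduced 1.
have [g gP] := choice mod_conductor_surj.
exists [seq g u | u <- us] => [e /mapP[u /us_simple u_simple ->] a|T s Tsub esT].
  have [au|[b bE]] := u_simple (pi a).
    by left; apply/mod_conductor_eq0; rewrite rmorphM /= gP.
  right; have [b' b'E] := mod_conductor_surj b; exists b'.
  apply/mod_conductor_eq0; rewrite rmorphB !rmorphM /= gP b'E bE; exact: subrr.
have cC : 1 - \sum_(e <- [seq g u | u <- us]) e \in conductor S.
  apply/mod_conductor_eq0; rewrite rmorphB rmorph1 rmorph_sum big_map /= one_us.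
  by under [X in _ - X]eq_bigr do rewrite gP; exact: subrr.
rewrite -[s]scale1r -[1](subrK (\sum_(e <- [seq g u | u <- us]) e)) scalerDl.
apply: subalgD => //; first exact: conductor_scale.
rewrite scaler_suml big_seq; elim/big_ind: _ => [|u v|e].
- exact: subalg0.
- exact: subalgD.
- exact: esT.
Qed.

(** With T = R, all points agree on T; the value c of a point at b satisfies
    c^2 = rho r and c rho(r) = rho q, which determines c. *)
Lemma etale_seminormal : seminormal S.
Proof.
move=> b [r b2] [q b3]; have [es es_simple glue] := simple_decomposition.
pose T : {pred S} := fun s => `[< exists r : R, s = r%:A >].
have Tsub : GRing.subalg_closed T.
  split=> [|a u v /asboolP[c ->] /asboolP[d ->]|u v /asboolP[c ->] /asboolP[d ->]];
    apply/asboolP.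
  - by exists 1; rewrite scale1r.
  - by exists (a * c + d); rewrite scalerDl scalerA.
  - by exists (c * d); rewrite mulr_algl scalerA.
suff /asboolP : b \in T by [].
apply: glue => // e /es_simple e_simple.
have [eC|eC] := boolP (e \in conductor S); first exact: conductor_scale.
have [K [rho [rs [_ sep]]]] := points_separate x_gen Omega0 e_simple eC.
apply: sep => // phi psi phiP psiP _.
have val chi : point rho chi -> chi b ^+ 2 = rho r /\ chi b * rho r = rho q.
  move=> chiP; have [_ _ chiM] := chiP.
  have E : chi b ^+ 2 = rho r by rewrite -(pointC r chiP) -b2 expr2 chiM.
  by split=> //; rewrite -E -(pointC q chiP) -b3 [b ^+ 3]exprS chiM !expr2 chiM.
have [[phi2 phi3] [psi2 psi3]] := (val phi phiP, val psi psiP).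
have [r0|r0] := eqVneq (rho r) 0; last first.
  by apply: (mulIf r0); rewrite phi3 psi3.
have z (c : K) : c ^+ 2 = 0 -> c = 0 by move/eqP; rewrite expf_eq0 => /eqP.
by rewrite (z _ (etrans phi2 r0)) (z _ (etrans psi2 r0)).
Qed.

Lemma joint_code (es : seq R) : (forall e, e \in es -> simple_mod_conductor S e) ->
  exists (J : finType) (code : {pred S} -> J), forall T T' : {pred S},
    GRing.subalg_closed T -> GRing.subalg_closed T' -> code T = code T' ->
    forall e t, e \in es -> t \in T -> e *: t \in T'.
Proof.
elim: es => [|e es IHes] es_simple; first by exists unit, (fun=> tt).
have [|J [code codeP]] := IHes.
  by move=> d des; apply: es_simple; rewrite inE des orbT.
have [J' [code' code'P]] := fibre_code x_gen Omega0 (es_simple e (mem_head _ _)).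
exists (J' * J)%type, (fun T => (code' T, code T)) => T T' Tsub T'sub [E' E] d t.
by rewrite inE => /orP[/eqP->|des] tT; [exact: (code'P T)|exact: (codeP T)].
Qed.

Lemma etale_FIP : has_FIP S.
Proof.
have [es es_simple glue] := simple_decomposition.
have [J [code codeP]] := joint_code es_simple.
have code_inj (T T' : pred S) : GRing.subalg_closed T -> GRing.subalg_closed T' ->
    code T = code T' -> T = T'.
  move=> Tsub T'sub E; apply: funext => t.
  apply/idP/idP => tT; apply: glue => // e ees.
    exact: (codeP T).
  exact: (codeP T').
have /choice[g gP] : forall j, exists T' : pred S,
    forall T : pred S, GRing.subalg_closed T -> code T = j -> T' = T.
  move=> j; have [[T [Tsub Tj]]|none] :=
    pselect (exists T : pred S, GRing.subalg_closed T /\ code T = j).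
    by exists T => T' T'sub T'j; apply: code_inj => //; rewrite Tj.
  by exists pred0 => T Tsub Tj; case: none; exists T.
apply: (@sub_finite_set _ _ (g @` [set: J])%classic); last exact: finite_image.
by move=> T Tsub; exists (code T) => //; exact: gP.
Qed.

End Etale.

(** * The quotient by the conductor under FIP *)

Section FIP.

(** The extension to S of the preimage of I in R. *)
Definition ext_ideal (I : set A) (s : S) := exists a : 'I_n -> R,
  (forall j, I (pi (a j))) /\ s = \sum_(j < n) a j *: x j.

Section ExtIdeal.
Variable I : set A.
Hypothesis I_ideal : ideal I.

Lemma ext_idealD s t : ext_ideal I s -> ext_ideal I t -> ext_ideal I (s + t).
Proof.
have [_ ID _] := I_ideal; move=> [a [aI ->]] [b [bI ->]].
exists (fun j => a j + b j); split=> [j|].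
  by rewrite rmorphD; exact: ID (aI j) (bI j).
by rewrite -big_split; apply: eq_bigr => j _; rewrite scalerDl.
Qed.

Lemma ext_ideal0 : ext_ideal I 0.
Proof.
have [I0 _ _] := I_ideal; exists (fun=> 0); split=> [j|].
  by rewrite rmorph0; exact: I0.
by rewrite big1 // => j _; rewrite scale0r.
Qed.

Lemma ext_ideal_scale c s : I (pi c) -> ext_ideal I (c *: s).
Proof.
have [_ _ IM] := I_ideal; move=> cI; have [b ->] := x_gen s.
exists (fun j => b j * c); split=> [j|]; first by rewrite rmorphM; exact: IM cI.
by rewrite scaler_sumr; apply: eq_bigr => j _; rewrite scalerA mulrC.
Qed.

Lemma ext_idealM s t : ext_ideal I s -> ext_ideal I (s * t).
Proof.
move=> [a [aI ->]]; rewrite mulr_suml.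
elim/big_ind: _ => [|u v|j _]; [exact: ext_ideal0|exact: ext_idealD|].
by rewrite -scalerAl; exact: ext_ideal_scale.
Qed.

(** The subalgebra R + IS. *)
Definition ext_subalg : pred S :=
  fun s => `[< exists r : R, ext_ideal I (s - r%:A) >].

Lemma ext_subalg_closed : GRing.subalg_closed ext_subalg.
Proof.
have IZ (c : R) s : ext_ideal I s -> ext_ideal I (c *: s).
  by rewrite -mulr_algl mulrC; exact: ext_idealM.
split=> [|c u v /asboolP[r ru] /asboolP[q qv]|u v /asboolP[r ru] /asboolP[q qv]];
  apply/asboolP.
- by exists 1; rewrite scale1r subrr; exact: ext_ideal0.
- exists (c * r + q).
  have -> : c *: u + v - (c * r + q)%:A = c *: (u - r%:A) + (v - q%:A).
    by rewrite scalerDl -scalerA opprD addrACA scalerBr.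
  by apply: ext_idealD => //; exact: IZ.
- exists (r * q).
  have -> : u * v - (r * q)%:A = (u - r%:A) * v + r *: (v - q%:A).
    by rewrite mulrBl scalerBr scalerA mulr_algl addrA subrK.
  by apply: ext_idealD; [exact: ext_idealM|exact: IZ].
Qed.

End ExtIdeal.

Hypothesis S_FIP : has_FIP S.

(** Otherwise the chain has an infinite strictly decreasing subsequence. *)
Lemma FIP_stable (u : nat -> pred S) : (forall k, GRing.subalg_closed (u k)) ->
    (forall k s, u k.+1 s -> u k s) ->
  exists N, forall m, (N <= m)%N -> u m = u N.
Proof.
move=> u_sub u_dec; apply: contrapT => nst.
have u_mono k m s : (k <= m)%N -> u m s -> u k s.
  by move/subnK <-; elim: (m - k)%N => // d IHd /u_dec.
have /choice[g gP] : forall N, exists m, (N <= m)%N /\ u m <> u N.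
  move=> N; apply: contrapT => none; apply: nst; exists N => m Nm.
  by apply: contrapT => neq; apply: none; exists m.
pose idx k := iter k g 0.
have idx_mono i j : (i <= j)%N -> (idx i <= idx j)%N.
  move/subnK <-; elim: (j - i)%N => // d IHd.
  by apply: leq_trans IHd _; rewrite addSn; case: (gP (idx (d + i)%N)).
have neq i j : (i < j)%N -> u (idx i) <> u (idx j).
  move=> ij E; have [_] := gP (idx i); apply; apply: funext => s.
  apply/idP/idP; first by apply: u_mono; case: (gP (idx i)).
  by rewrite E; apply: u_mono; exact: (idx_mono i.+1).
have idx_inj : injective (fun k => u (idx k)).
  by move=> i j E; case: (ltngtP i j) => // /neq; rewrite E.
apply: infinite_nat.
have -> : [set: nat]%classic =
    ((fun k => u (idx k)) @^-1` [set T : pred S | GRing.subalg_closed T])%classic.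
  by apply/seteqP; split=> // k _; exact: u_sub.
by apply: finite_preimage => // i j _ _; exact: idx_inj.
Qed.

Lemma FIP_chain (I : nat -> set A) : (forall k, ideal (I k)) ->
    (forall k, (I k.+1 `<=` I k)%classic) ->
  exists N, forall m, (N <= m)%N -> forall c j, I N (pi c) ->
    exists r : R, ext_ideal (I m) (c *: x j - r%:A).
Proof.
move=> I_id I_dec; have [|k s|N NP] := @FIP_stable (fun k => ext_subalg (I k)).
- by move=> k; exact: ext_subalg_closed.
- move=> /asboolP[r [a [aI sE]]]; apply/asboolP; exists r, a; split=> // j.
  exact/I_dec/aI.
exists N => m Nm c j cI.
suff : ext_subalg (I m) (c *: x j) by move/asboolP.
rewrite NP //; apply/asboolP; exists 0; rewrite scale0r subr0.
exact: ext_ideal_scale.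
Qed.

Hypothesis A_reduced : reduced_ring A.

(** Lift y to r.  The subalgebras R + r^k S stabilize at some N, so r^N x_i
    is, modulo R, a combination of the r^(N+1) x_j, and (1 - r W) (r^N x_j)_j
    has entries in R for some matrix W.  Multiplying by the adjugate,
    det (1 - r W) r^N lies in C; and the determinant is 1 - b r for some b. *)
Lemma FIP_regular (y : A) : exists u, y = u * y * y.
Proof.
have I_dec k : ([set z | exists c, z = c * y ^+ k.+1] `<=`
                [set z | exists c, z = c * y ^+ k])%classic.
  by move=> z [c ->]; exists (c * y); rewrite exprS mulrA.
have [N /(_ N.+1 (leqnSn N)) NP] :=
  FIP_chain (fun k => principal_ideal (y ^+ k)) I_dec.
have [r rE] := mod_conductor_surj y.
have /choice[w wP] : forall i, exists w : 'I_n -> R, exists q : R,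
    r ^+ N *: x i - \sum_(j < n) (w j * r ^+ N.+1) *: x j = q%:A.
  move=> i; have [|q [a [aI aE]]] := NP (r ^+ N) i.
    by exists 1; rewrite rmorphXn mul1r /= rE.
  have /choice[w wP] : forall j, exists w, a j - w * r ^+ N.+1 \in conductor S.
    move=> j; have [c cE] := aI j; have [w wc] := mod_conductor_surj c.
    exists w; apply/mod_conductor_eq0.
    rewrite rmorphB rmorphM rmorphXn /= cE wc rE; exact: subrr.
  exists w.
  have [|c cE] := @alg_sum _ (fun j => (a j - w j * r ^+ N.+1) *: x j).
    by move=> j; have /asboolP/(_ (x j)) := wP j; rewrite mulr_algl.
  exists (q + c); rewrite scalerDl -cE.
  under [X in _ = _ + X]eq_bigr do rewrite scalerBl.
  by rewrite sumrB -aE addrA [q%:A + _]addrC subrK.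
have [q qE] := choice wP.
pose W : 'M[R]_n := \matrix_(i, j) w i j; have [b bE] := det_one_sub_mul W r.
pose M := 1%:M - r *: W; pose v : 'cV[S]_n := \col_j (r ^+ N *: x j).
have Mv : map_mx (in_alg S) M *m v = map_mx (in_alg S) (\col_j q j).
  apply/matrixP => i k; rewrite !mxE /= -qE.
  under eq_bigr do rewrite !mxE /= mulr_algl.
  transitivity (\sum_j ((i == j)%:R *: (r ^+ N *: x j)
                  - (w i j * r ^+ N.+1) *: x j)).
    apply: eq_bigr => j _; rewrite scalerBl; congr (_ - _).
    by rewrite scalerA exprS mulrA [w i j * r]mulrC.
  rewrite sumrB; congr (_ - _); rewrite (bigD1 i) //= eqxx scale1r big1 ?addr0 //.
  by move=> j; rewrite eq_sym => /negPf->; rewrite scale0r.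
have detC : \det M * r ^+ N \in conductor S.
  apply: conductor_gen => j; exists ((\adj M *m \col_j q j) j 0).
  have : (\det (map_mx (in_alg S) M))%:M *m v =
      map_mx (in_alg S) (\adj M *m \col_j q j).
    by rewrite -mul_adj_mx -mulmxA Mv map_mxM map_mx_adj.
  rewrite mul_scalar_mx det_map_mx => /matrixP/(_ j 0).
  by rewrite [RHS]mxE /= => <-; rewrite !mxE /= mulr_algl scalerA.
exists (pi b); apply: (reduced_regular (n := N)) => //.
move/mod_conductor_eq0: detC; rewrite /M bE mulrBl mul1r -mulrA -exprS.
by rewrite rmorphB rmorphM !rmorphXn /= rE => /subr0_eq.
Qed.

(** Let R + I_m S = R + I_N S and let z be in I_N.  By regularity z = e z for
    some e in I_N.  The e x_j lie in R + I_m S; let f in I_m be a unit for the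
    finitely many coefficients involved.  Then (1 - f) e x_j lies in R for all
    j, that is, (1 - f) e = 0 in A, and z = f e z lies in I_m. *)
Lemma FIP_artinian : artinian A.
Proof.
move=> I I_id I_dec; have [N NP] := FIP_chain I_id I_dec; exists N => m Nm.
have [_ _ INM] := I_id N; have [_ _ ImM] := I_id m.
apply/seteqP; split=> [z|z zI].
  by move: Nm => /subnK <-; elim: (m - N)%N => // d IHd /I_dec.
have [u zE] := FIP_regular z; have [e eE] := mod_conductor_surj (u * z).
have /choice[q qP] : forall j, exists r : R, ext_ideal (I m) (e *: x j - r%:A).
  by move=> j; apply: NP; rewrite // eE; exact: INM.
have [a aP] := choice qP.
have [|f fI fP] := @ideal_local_unit A (I m)
    [seq pi (a p.1 p.2) | p <- enum {: 'I_n * 'I_n}] FIP_regular (I_id m).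
  by move=> b /mapP[p _ ->]; case: (aP p.1).
have [g gE] := mod_conductor_surj f.
have geC : (1 - g) * e \in conductor S.
  apply: conductor_gen => j; have [_ aE] := aP j.
  have [|c cE] := @alg_sum _ (fun k => ((1 - g) * a j k) *: x k).
    move=> k; suff /asboolP/(_ (x k)) : (1 - g) * a j k \in conductor S.
      by rewrite mulr_algl.
    apply/mod_conductor_eq0; rewrite rmorphM rmorphB rmorph1 /= gE mulrBl mul1r.
    rewrite fP; first exact: subrr.
    by apply/mapP; exists (j, k); rewrite ?mem_enum.
  have ex : e *: x j = (q j)%:A + \sum_k a j k *: x k by rewrite -aE addrC subrK.
  exists ((1 - g) * q j + c); rewrite [RHS]scalerDl -cE -scalerA ex.
  rewrite scalerDr scalerA scaler_sumr; congr (_ + _).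
  by apply: eq_bigr => k _; rewrite scalerA.
move/mod_conductor_eq0: geC; rewrite rmorphM rmorphB rmorph1 /= gE eE mulrBl mul1r.
by move/subr0_eq => efe; rewrite zE efe -mulrA -mulrC; exact: ImM.
Qed.

End FIP.
End Generated.
End ModConductor.

Theorem theorem6p2 (R : comNzRingType) (S : comAlgType R)
    (inj_RS : injective (GRing.in_alg S))
    (S_finite : module_finite S) (S_etale : etale S) :
  ((has_FIP S /\ seminormal S) <->
     (artinian (mod_conductor S) /\ reduced_ring (mod_conductor S))) /\
  ((has_FIP S /\ reduced_ring (mod_conductor S)) <->
     (seminormal S /\ artinian (mod_conductor S))).
Proof.
have [_ _ Omega0] := S_etale; have [n [x x_gen]] := S_finite.
have red := @seminormal_reduced R S.
have fip_art F A := FIP_artinian x_gen (S := S) F A.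
have sn A B := etale_seminormal x_gen Omega0 (S := S) A B.
have fip A B := etale_FIP x_gen Omega0 (S := S) A B.
split; split=> -[h1 h2].
- by have A_red := red h2; split=> //; exact: fip_art.
- by split; [exact: fip|exact: sn].
- by have A_art := fip_art h1 h2; split=> //; exact: sn.
- by have A_red := red h1; split=> //; exact: fip.
Qed.
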